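(* Let $F\subset\mathbb{R}^d$ be a compact convex set with $0\in\operatorname{int}(F)$, let $m\ge 2$, and let $\Omega^1,\dots,\Omega^m\subset\mathbb{R}^d$ be nonempty compact sets. Then the set $S_1$ of global minimizers over $\mathbb{R}^d$ of $f_1(x)=\sum_{i=1}^m T_F(x,\Omega^i)$ is compact.
   Context: $\mathbb{R}^d$ ($d\ge1$) carries the Euclidean norm. For a nonempty set $\Omega\subset\mathbb{R}^d$ the minimal time function is $T_F(x,\Omega)=\inf\{t\ge 0\mid (x+tF)\cap\Omega\neq\emptyset\}$, $x\in\mathbb{R}^d$. $S_1=\{y\in\mathbb{R}^d\mid f_1(y)=\min_{x\in\mathbb{R}^d}f_1(x)\}$. *)

(* Defs.v *)
From HB Require Import structures.
From mathcomp Require Import all_boot all_order all_algebra.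
From mathcomp Require Import all_classical all_reals all_analysis.

Set Implicit Arguments.
Unset Strict Implicit.
Unset Printing Implicit Defensive.

Import Order.TTheory GRing.Theory Num.Theory.
Import numFieldNormedType.Exports.

Local Open Scope classical_set_scope.
Local Open Scope ring_scope.

(* The space R^d is 'rV[R]_d. Its library norm is the max norm, which induces
   the Euclidean topology; only the topology is used (compactness, interior). *)

(* The infimum is taken in \bar R, so that it is +oo when no t >= 0 is
   admissible (the real-valued inf of an empty set would be 0). *)
Definition minimal_time (R : realType) (d : nat) (F : set 'rV[R]_d)
    (x : 'rV[R]_d) (Omega : set 'rV[R]_d) : \bar R :=
  ereal_inf [set t%:E | t in
    [set t : R | 0 <= t /\ [set x + t *: v | v in F] `&` Omega !=set0]].

Definition total_time (R : realType) (d m : nat) (F : set 'rV[R]_d)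
    (Omega : 'I_m -> set 'rV[R]_d) (x : 'rV[R]_d) : \bar R :=
  (\sum_(i < m) minimal_time F x (Omega i))%E.

Definition global_minimizers (R : realType) (T : Type) (f : T -> \bar R) :
    set T :=
  [set y | forall x, (f y <= f x)%E].

(* Main.v *)
Require Import Defs.
From HB Require Import structures.
From mathcomp Require Import all_boot all_order all_algebra.
From mathcomp Require Import all_classical all_reals all_analysis.

(** Since F is convex and contains a ball of radius r around 0, the time to
    cover y - x can be prepended to any trajectory from y, so that each
    T_F(., Omega^i) is 1/r-Lipschitz and S_1 is closed. Since F is contained in
    a ball of radius M and Omega^i in a ball of radius B,
    T_F(x, Omega^i) >= (|x| - B) / M, so that S_1 is bounded. *)

Import Order.TTheory GRing.Theory Num.Theory.
Import numFieldNormedType.Exports.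

Local Open Scope classical_set_scope.
Local Open Scope ring_scope.

Lemma interior0_ball (R : realType) (V : normedModType R) (F : set V) :
  interior F 0 -> exists2 r : R, 0 < r & forall v, `|v| <= r -> F v.
Proof.
move=> /nbhs_ballP[e /= e0 eF]; exists (e / 2); first exact: divr_gt0.
move=> v vr; apply: eF; rewrite -ball_normE /ball_ /= sub0r normrN.
by apply: le_lt_trans vr _; rewrite ltr_pdivrMr// ltr_pMr// ltr1n.
Qed.

Lemma compact_norm_bound (R : realType) (V : normedModType R) (A : set V) :
  compact A -> exists2 M : R, 0 < M & forall v, A v -> `|v| <= M.
Proof.
move=> /compact_bounded/ex_strict_bound_gt0[M M0 AM].
by exists M => // v /AM /= /ltW.
Qed.

(** Dividing the weights by [s + t] turns them into a convex combination. This is the inclusion sF +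
    tF ⊆ (s + t)F, used to merge two successive displacements into one. *)
Lemma convex_set_weighted (R : realType) (V : lmodType R) (F : set V)
    (s t : R) (u v : V) :
  convex_set F -> 0 <= s -> 0 <= t -> 0 < s + t -> F u -> F v ->
  exists2 w, F w & (s + t) *: w = s *: u + t *: v.
Proof.
move=> cF s0 t0 st0 Fu Fv.
have k0 : 0 <= s / (s + t) by rewrite divr_ge0// ltW.
have k1 : s / (s + t) <= 1 by rewrite ler_pdivrMr// mul1r lerDl.
have := cF u v (Itv01 k0 k1); rewrite !inE => /(_ Fu Fv) Fw.
exists (s / (s + t) *: u + (1 - s / (s + t)) *: v) => //.
rewrite scalerDr !scalerA mulrBr mulr1.
by rewrite mulrCA divff ?gt_eqF// mulr1 addrAC subrr add0r.
Qed.

Section minimal_time.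
Variables (R : realType) (d : nat) (F : set 'rV[R]_d).

Lemma minimal_time_ge0 (x : 'rV[R]_d) (O : set 'rV[R]_d) :
  (0 <= minimal_time F x O)%E.
Proof. by apply: le_ereal_inf_tmp => _ [t [t0 _] <-]; rewrite lee_fin. Qed.

Lemma total_time_ge (m : nat) (Omega : 'I_m -> set 'rV[R]_d) (i : 'I_m)
    (x : 'rV[R]_d) :
  (minimal_time F x (Omega i) <= total_time F Omega x)%E.
Proof.
rewrite /total_time (bigD1 i)//= leeDl// sume_ge0// => j _.
exact: minimal_time_ge0.
Qed.

Lemma minimal_time_ge_norm (M B : R) (O : set 'rV[R]_d) (x : 'rV[R]_d) :
  0 < M -> (forall v, F v -> `|v| <= M) -> (forall w, O w -> `|w| <= B) ->
  (((`|x| - B) / M)%:E <= minimal_time F x O)%E.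
Proof.
move=> M0 FM OB; apply: le_ereal_inf_tmp => _ [t [t0 [w [[v Fv <-] Ow]]] <-].
rewrite lee_fin ler_pdivrMr// lerBlDl.
(* Write x = w - t v, where w = x + t v is the point reached in [O]. *)
rewrite -[x in leLHS](addrK (t *: v)).
apply: (le_trans (ler_normB _ _)); apply: lerD; first exact: OB.
by rewrite normrZ ger0_norm// ler_wpM2l// FM.
Qed.

Variable r : R.
Hypotheses (r0 : 0 < r) (rF : forall v, `|v| <= r -> F v).

Lemma ball_admissible (x y : 'rV[R]_d) :
  exists2 u, F u & y - x = (`|y - x| / r) *: u.
Proof.
have [yx|yx] := eqVneq (y - x) 0.
  exists 0; first by apply: rF; rewrite normr0 ltW.
  by rewrite scaler0.
have n0 : 0 < `|y - x| by rewrite normr_gt0.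
(* The displacement is rescaled to norm exactly [r]. *)
exists ((r / `|y - x|) *: (y - x)).
  apply: rF; rewrite normrZ ger0_norm; last by rewrite divr_ge0// ltW.
  by rewrite divfK ?gt_eqF.
by rewrite scalerA mulrA divfK ?gt_eqF// divff ?gt_eqF// scale1r.
Qed.

Lemma minimal_time_lty (x : 'rV[R]_d) (O : set 'rV[R]_d) :
  O !=set0 -> (minimal_time F x O < +oo)%E.
Proof.
move=> [w Ow]; have [u Fu wx] := ball_admissible x w.
apply: (@le_lt_trans _ _ (`|w - x| / r)%:E); last exact: ltry.
apply: ereal_inf_lbound; exists (`|w - x| / r) => //; split.
  by rewrite divr_ge0// ltW.
by exists w; split => //; exists u => //; rewrite -wx addrC subrK.
Qed.

(** Going from x to y takes time at most |y - x| / r; continuing from y to the target in time t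
    gives, by convexity of [F], a single admissible move from x in the total time. *)
Lemma minimal_time_lipschitz (x y : 'rV[R]_d) (O : set 'rV[R]_d) :
  convex_set F ->
  (minimal_time F x O <= minimal_time F y O + (`|y - x| / r)%:E)%E.
Proof.
move=> cF; rewrite -leeBlDr//; apply: le_ereal_inf_tmp.
move=> _ [t [t0 [w [[v Fv vw] Ow]]] <-].
rewrite leeBlDr// -EFinD addrC; set s := `|y - x| / r.
have s0 : 0 <= s by rewrite divr_ge0// ltW.
have [u Fu yx] := ball_admissible x y.
apply: ereal_inf_lbound; exists (s + t) => //; split; first exact: addr_ge0.
exists w; split => //.
have : 0 <= s + t by exact: addr_ge0.
(* Weights of sum zero cannot be normalised; in that case s = t = 0, so x = y = w and any point of
   [F] serves. *)
rewrite le_eqVlt => /predU1P[/esym st0|st0].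
  move/eqP: (st0); rewrite paddr_eq0// => /andP[/eqP s00 /eqP t00].
  exists v => //; rewrite st0 -vw t00 scale0r !addr0; apply/esym/eqP.
  by rewrite -subr_eq0 yx -/s s00 scale0r.
have [v' Fv' v'E] := convex_set_weighted _ _ _ _ _ _ _ cF s0 t0 st0 Fu Fv.
by exists v' => //; rewrite v'E -yx addrA [x + _]addrC subrK.
Qed.

Lemma total_time_lty (m : nat) (Omega : 'I_m -> set 'rV[R]_d) (x : 'rV[R]_d) :
  (forall i, Omega i !=set0) -> (total_time F Omega x < +oo)%E.
Proof. by move=> O0; apply: lte_sum_pinfty => i _; exact: minimal_time_lty. Qed.

Lemma total_time_lipschitz (m : nat) (Omega : 'I_m -> set 'rV[R]_d)
    (x y : 'rV[R]_d) :
  convex_set F ->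
  (total_time F Omega x <=
   total_time F Omega y + (m%:R * (`|y - x| / r))%:E)%E.
Proof.
move=> cF; rewrite mulr_natl -[X in _ *+ X](card_ord m) -sumr_const -sumEFin.
by rewrite -big_split /=; apply: lee_sum => i _; exact: minimal_time_lipschitz.
Qed.

End minimal_time.

(** A point y of the closure has a minimizer z within e / k, whence f y <= f z + e <= f x + e for
    every e > 0. *)
Lemma closed_global_minimizers_lipschitz (R : realType) (V : normedModType R)
    (f : V -> \bar R) (k : R) :
  0 < k -> (forall x y, f x <= f y + (k * `|y - x|)%:E)%E ->
  closed (global_minimizers f).
Proof.
move=> k0 fk y Sy x; apply/lee_addgt0Pr => e e0.
have [|z [Sz]] := Sy (ball y (e / k)).
  by apply: nbhsx_ballx; exact: divr_gt0.
rewrite -ball_normE /ball_ /= distrC ltr_pdivlMr// mulrC => /ltW yz.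
by apply: (le_trans (fk y z)); apply: leeD; [exact: Sz|rewrite lee_fin].
Qed.

Theorem proposition4p2 (R : realType) (d m : nat) (d_ge1 : (1 <= d)%N)
    (m_ge2 : (2 <= m)%N) (F : set 'rV[R]_d) (Omega : 'I_m -> set 'rV[R]_d)
    (F_compact : compact F) (F_convex : convex_set F)
    (F_int0 : interior F 0)
    (Omega_neq0 : forall i, Omega i !=set0)
    (Omega_compact : forall i, compact (Omega i)) :
  compact (global_minimizers (total_time F Omega)).
Proof.
have m0 : (0 < m)%N by exact: ltn_trans m_ge2.
have [r r0 rF] := interior0_ball _ _ _ F_int0.
apply: bounded_closed_compact; last first.
  (* Each of the [m] summands contributes a Lipschitz constant 1 / r. *)
  apply: (@closed_global_minimizers_lipschitz _ _ _ (m%:R / r)).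
    by rewrite divr_gt0// ltr0n.
  move=> x y; rewrite mulrAC -mulrA.
  exact: total_time_lipschitz.
have [M M0 FM] := compact_norm_bound _ _ _ F_compact.
(* One target set is enough for boundedness, since the sum dominates each of its nonnegative
   terms. *)
have [B _ OB] := compact_norm_bound _ _ _ (Omega_compact (Ordinal m0)).
have f0 : total_time F Omega 0 \is a fin_num.
  rewrite ge0_fin_numE; first exact: total_time_lty r0 rF _ _ _ Omega_neq0.
  by apply: sume_ge0 => i _; exact: minimal_time_ge0.
(* The origin is the competitor: a minimizer y satisfies (|y| - B) / M <= f_1(y) <= f_1(0), and
   f_1(0) is finite. *)
exists (B + fine (total_time F Omega 0) * M); split; first exact: num_real.
move=> N /ltW BN y Sy /=; apply: le_trans BN.
rewrite -lerBlDl -ler_pdivrMr// -lee_fin fineK//.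
apply: le_trans (Sy 0); apply: le_trans (total_time_ge _ _ _ _ _ (Ordinal m0) _).
exact: minimal_time_ge_norm.
Qed.
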